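(* There is a constant $c>0$ such that for every $n\ge 2$ and every poset $P=(S,\preceq)$ with $|S|=n$, letting $G_r=(S,E_r)$ be the transitive reduction graph of $P$, there is a data structure representing $G_r$ that occupies at most $n^2/4 + c\,(n^2\lg\lg n)/\lg n$ bits and, given two elements $a,b\in S$, reports whether $(a,b)\in E_r$ in $O(1)$ time.
   Context: A poset $P=(S,\preceq)$ is a reflexive, antisymmetric, transitive binary relation on a finite set $S$; write $a\prec b$ if $a\preceq b$ and $a\ne b$. The transitive reduction graph of $P$ is the directed graph $G_r=(S,E_r)$ with $E_r=\{(a,b): a\prec b \text{ and there is no } c\in S \text{ with } a\prec c\prec b\}$. Here $\lg n=\lceil\log_2 n\rceil$. The model is the word-RAM with word size $\Theta(\lg n)$ bits; elements are identified by distinct integer labels in $\{1,\dots,n\}$; space is measured in bits. *)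

(* Defs.v *)
From mathcomp Require Import all_boot all_order all_algebra.

Set Implicit Arguments.
Unset Strict Implicit.
Unset Printing Implicit Defensive.

Import Order.TTheory.

(* Ceiling of the base-2 logarithm; in particular lg 1 = 0 and lg 2 = 1. *)
Definition lg (n : nat) : nat := up_log 2 n.

Definition trans_red (d : Order.disp_t) (T : finPOrderType d) : rel T :=
  fun a b => (a < b)%O && ~~ [exists c : T, (a < c)%O && (c < b)%O].

Definition labelling (n : nat) (T : Type) (lab : T -> nat) : Prop :=
  injective lab /\ forall x : T, 1 <= lab x <= n.

(* Word size Theta(lg n).  The lower constant is 2 because a word has to be able
   to address the order of n ^ 2 memory cells. *)
Definition word_size_Theta_lg (w : nat -> nat) : Prop :=
  (forall n, 2 <= n -> 2 * lg n <= w n) /\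
  exists K : nat, forall n, 2 <= n -> w n <= K * lg n.

(* Word-RAM with w-bit words: a word is a natural number below 2 ^ w and all the
   arithmetic is modulo 2 ^ w. *)

Inductive binop : Type :=
  OpAdd | OpSub | OpMul | OpDiv | OpMod | OpAnd | OpOr | OpXor | OpShl | OpShr.

Definition eval_binop (w : nat) (o : binop) (x y : nat) : nat :=
  (match o with
   | OpAdd => x + y
   | OpSub => x + (2 ^ w - y)
   | OpMul => x * y
   | OpDiv => x %/ y
   | OpMod => x %% y
   | OpAnd => Nat.land x y
   | OpOr => Nat.lor x y
   | OpXor => Nat.lxor x y
   | OpShl => x * 2 ^ y
   | OpShr => x %/ 2 ^ y
   end) %% 2 ^ w.

(* Arguments are register numbers, except the literal k of Const and the jump
   targets l, which are positions in the program. *)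
Inductive instr : Type :=
  | Const (r k : nat)               (* r := k *)
  | Binop (o : binop) (r x y : nat) (* r := x o y *)
  | Read (r x : nat)                (* r := M[x] *)
  | Write (x y : nat)               (* M[x] := y *)
  | JumpEq (x y l : nat)            (* if x = y goto l *)
  | JumpLt (x y l : nat)            (* if x < y goto l *)
  | Halt.

Definition program : Type := seq instr.

Record state : Type := State {
  pc : nat;
  regs : nat -> nat;
  mem : nat -> nat
}.

Definition upd (f : nat -> nat) (i v : nat) : nat -> nat :=
  fun j => if j == i then v else f j.

Definition exec (w : nat) (i : instr) (s : state) : state :=
  let R := regs s in
  let M := mem s in
  match i with
  | Const r k => State (pc s).+1 (upd R r (k %% 2 ^ w)) M
  | Binop o r x y => State (pc s).+1 (upd R r (eval_binop w o (R x) (R y))) M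
  | Read r x => State (pc s).+1 (upd R r (M (R x))) M
  | Write x y => State (pc s).+1 R (upd M (R x) (R y))
  | JumpEq x y l => State (if R x == R y then l else (pc s).+1) R M
  | JumpLt x y l => State (if R x < R y then l else (pc s).+1) R M
  | Halt => s
  end.

(* The final state if Halt is reached after executing at most t instructions;
   None on timeout or when the program counter leaves the program. *)
Fixpoint run (w : nat) (p : program) (t : nat) (s : state) : option state :=
  match onth p (pc s) with
  | Some Halt => Some s
  | Some i => if t is t'.+1 then run w p t' (exec w i s) else None
  | None => None
  end.

(* The bit string B laid out from address 0 on, w bits per word, least
   significant bit first; the rest of the memory is 0. *)
Definition pack (w : nat) (B : seq bool) : nat -> nat :=
  fun i => \sum_(j < w) nth false B (i * w + j) * 2 ^ j.

(* Besides the two query labels, the program only gets the length of the bit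
   string: neither n nor w is passed to it. *)
Definition query_state (w : nat) (B : seq bool) (x y : nat) : state :=
  State 0
    (fun r => match r with
              | 0 => size B %% 2 ^ w
              | 1 => x %% 2 ^ w
              | 2 => y %% 2 ^ w
              | _ => 0
              end)
    (pack w B).

(* Within t steps the query (x, y) leaves its answer, 1 or 0, in register 0 and
   the memory as it was, so that the structure can be queried again. *)
Definition answers (w : nat) (p : program) (t : nat) (B : seq bool)
    (x y : nat) (ans : bool) : Prop :=
  exists2 s : state, run w p t (query_state w B x y) = Some s &
    regs s 0 = ans /\ mem s =1 pack w B.

(* Main.v *)
(** The transitive reduction of a poset, with orientations forgotten, is
    triangle-free; the orientation of an edge is recovered by comparing the sizes
    of the down-sets of its ends.  In a triangle-free graph no vertex has neighbours
    on both sides of a biclique K_{q,q}, so q + 2 bits describe its adjacency to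
    these 2q vertices.  Removing disjoint bicliques greedily, and recording each
    pair only once, costs n^2 / 4 + O(n^2 / q) bits.  What remains contains no
    K_{q,q}; for q of order lg n / lg lg n a pigeonhole argument then leaves at most
    O(n^2 / lg^3 n) edges.  Every row is therefore cut into blocks of about lg^2 n
    bits that are reached through a table of pointers, all zero blocks being shared:
    this stores the remaining edges in o(n^2) bits and gives constant-time access. *)

Require Import Defs.
From mathcomp Require Import all_boot all_order all_algebra zify ring.

Set Implicit Arguments.
Unset Strict Implicit.
Unset Printing Implicit Defensive.

Import Order.TTheory GRing.Theory Num.Theory.
Local Open Scope ring_scope.

(** * Words and bits *)

Section Words.
Local Open Scope nat_scope.

Definition word_of_bits (w : nat) (b : nat -> bool) : nat :=
  \sum_(j < w) b j * 2 ^ j.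

Lemma word_of_bitsS w b :
  word_of_bits w.+1 b = b 0 + 2 * word_of_bits w (fun j => b j.+1).
Proof.
rewrite /word_of_bits big_ord_recl /= muln1 big_distrr /=; congr (_ + _).
by apply: eq_bigr => i _; rewrite expnS mulnCA.
Qed.

Lemma word_of_bits_lt w b : word_of_bits w b < 2 ^ w.
Proof.
elim: w b => [|w IHw] b; first by rewrite /word_of_bits big_ord0.
rewrite word_of_bitsS expnS; have := IHw (fun j => b j.+1); case: (b 0); lia.
Qed.

Lemma bit_of_word_of_bits w b o :
  o < w -> (word_of_bits w b %/ 2 ^ o) %% 2 = b o.
Proof.
elim: w b o => [//|w IHw] b [|o] ltow; rewrite word_of_bitsS.
  by rewrite expn0 divn1; case: (b 0); lia.
rewrite expnS divnMA -[RHS](IHw (fun j => b j.+1)) //.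
suff -> : (b 0 + 2 * word_of_bits w (fun j => b j.+1)) %/ 2
          = word_of_bits w (fun j => b j.+1) by [].
by case: (b 0); lia.
Qed.

Lemma word_of_bits_digits w x :
  x < 2 ^ w -> word_of_bits w (fun j => odd (x %/ 2 ^ j)) = x.
Proof.
elim: w x => [|w IHw] x; first by case: x => //; rewrite /word_of_bits big_ord0.
rewrite expnS => ltx; rewrite word_of_bitsS expn0 divn1.
have -> : word_of_bits w (fun j => odd (x %/ 2 ^ j.+1)) = x %/ 2.
  rewrite -[RHS]IHw ?ltn_divLR 1?mulnC //; apply: eq_bigr => i _.
  by rewrite expnS divnMA.
by rewrite divn2 mul2n odd_double_half.
Qed.

Definition bits_of_words (w N : nat) (m : nat -> nat) : seq bool :=
  mkseq (fun i => odd (m (i %/ w) %/ 2 ^ (i %% w))) (N * w).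

Lemma pack_bits_of_words w N m i :
  i < N -> m i < 2 ^ w -> pack w (bits_of_words w N m) i = m i.
Proof.
move=> ltiN ltm; rewrite -[RHS](word_of_bits_digits ltm).
apply: eq_bigr => j _; rewrite nth_mkseq; last first.
  apply: (@leq_trans (i.+1 * w)); last by rewrite leq_mul2r ltiN orbT.
  by rewrite mulSn addnC ltn_add2r.
have w_gt0 : 0 < w by case: (w) j => [[]|].
by rewrite divnMDl // modnMDl modn_small // (divn_small (ltn_ord j)) addn0.
Qed.

End Words.

(** * Running programs *)

Section Machine.
Local Open Scope nat_scope.
Variables (w : nat) (p : program).

Lemma run_halt t c R M : onth p c = Some Halt ->
  run w p t (State c R M) = Some (State c R M).
Proof. by case: t => [|t] /= ->. Qed.

Lemma run_const t c R M r k : onth p c = Some (Const r k) -> k < 2 ^ w ->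
  run w p t.+1 (State c R M) = run w p t (State c.+1 (upd R r k) M).
Proof. by move=> /= -> ltk; rewrite /exec /= modn_small. Qed.

Lemma run_read t c R M r x a v : onth p c = Some (Read r x) ->
  R x = a -> M a = v ->
  run w p t.+1 (State c R M) = run w p t (State c.+1 (upd R r v) M).
Proof. by move=> /= -> <- <-. Qed.

Lemma run_binop t c R M o r x y a b v : onth p c = Some (Binop o r x y) ->
  R x = a -> R y = b -> eval_binop w o a b = v ->
  run w p t.+1 (State c R M) = run w p t (State c.+1 (upd R r v) M).
Proof. by move=> /= -> <- <- <-. Qed.

Lemma run_jeq t c R M x y l (e : bool) : onth p c = Some (JumpEq x y l) ->
  (R x == R y) = e ->
  run w p t.+1 (State c R M) = run w p t (State (if e then l else c.+1) R M).
Proof. by move=> /= -> <-. Qed.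

Lemma run_jlt t c R M x y l (e : bool) : onth p c = Some (JumpLt x y l) ->
  (R x < R y) = e ->
  run w p t.+1 (State c R M) = run w p t (State (if e then l else c.+1) R M).
Proof. by move=> /= -> <-. Qed.

Lemma eval_add x y : x + y < 2 ^ w -> eval_binop w OpAdd x y = x + y.
Proof. exact: modn_small. Qed.

Lemma eval_mul x y : x * y < 2 ^ w -> eval_binop w OpMul x y = x * y.
Proof. exact: modn_small. Qed.

Lemma eval_div x y : x < 2 ^ w -> eval_binop w OpDiv x y = x %/ y.
Proof. by move=> ltx; apply/modn_small/(leq_ltn_trans _ ltx)/leq_div. Qed.

Lemma eval_mod x y : x < 2 ^ w -> eval_binop w OpMod x y = x %% y.
Proof. by move=> ltx; apply/modn_small/(leq_ltn_trans _ ltx)/leq_mod. Qed.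

Lemma eval_shr x y : x < 2 ^ w -> eval_binop w OpShr x y = x %/ 2 ^ y.
Proof. by move=> ltx; apply/modn_small/(leq_ltn_trans _ ltx)/leq_div. Qed.

End Machine.

(** * Bicliques in finite graphs *)

Section Graph.
Local Open Scope nat_scope.
Variables (T : finType) (adj : rel T) (q : nat).

Definition biclique (A B : {set T}) : bool :=
  [&& #|A| == q, #|B| == q & [forall a in A, forall b in B, adj a b]].

Definition biclique_free (R : {set T}) : Prop :=
  forall A B : {set T}, A \subset R -> B \subset R -> ~~ biclique A B.

Lemma bicliqueP (A B : {set T}) :
  reflect [/\ #|A| = q, #|B| = q & {in A & B, forall a b, adj a b}] (biclique A B).
Proof.
apply: (iffP and3P) => [[/eqP ? /eqP ? /forall_inP h]|[-> -> h]].
  by split=> // a b aA bB; have /forall_inP := h a aA; apply.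
split; rewrite ?eqxx //; apply/forall_inP => a aA; apply/forall_inP => b bB; exact: h.
Qed.

Hypothesis adj_irr : irreflexive adj.
Hypothesis q_gt0 : 0 < q.

(** Induction on the cardinal of [R], taking out one biclique at a time; its sides are disjoint
    because [adj] has no loops. Listing the bicliques one after the other makes the biclique, side
    and offset of a vertex computable from its position. *)
Lemma biclique_decomposition (x0 : T) (R : {set T}) : exists (K : nat) (s : seq T),
  [/\ uniq s, s =i R, 2 * q * K <= size s,
      forall k i j, k < K -> i < q -> j < q ->
        adj (nth x0 s (2 * q * k + i)) (nth x0 s (2 * q * k + q + j))
    & biclique_free [set x in drop (2 * q * K) s]].
Proof.
have [m] := ubnP #|R|; elim: m R => // m IHm R ltRm.
case: (boolP [exists A : {set T}, exists B : {set T},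
        [&& A \subset R, B \subset R & biclique A B]]) => [|noAB]; last first.
  exists 0, (enum R); rewrite muln0 drop0; split; rewrite ?enum_uniq //.
    exact: mem_enum.
  move=> A B sAR sBR; apply: contra noAB => cAB; apply/existsP; exists A.
  apply/existsP; exists B; apply/and3P; split=> //.
    by apply: subset_trans sAR _; apply/subsetP=> x; rewrite inE mem_enum.
  by apply: subset_trans sBR _; apply/subsetP=> x; rewrite inE mem_enum.
case/existsP=> A /existsP[B /and3P[sAR sBR /bicliqueP[cA cB cAB]]].
have dAB : [disjoint A & B].
  apply/pred0P => x /=; apply/negbTE/andP => -[xA xB].
  by have := cAB x x xA xB; rewrite adj_irr.
have [|K [s [us sR szs sbi sfree]]] := IHm (R :\: (A :|: B)).
  rewrite -ltnS; apply: leq_trans ltRm; rewrite ltnS; apply: proper_card.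
  have /card_gt0P[a aA] : 0 < #|A| by rewrite cA.
  apply/properP; split; first exact: subsetDl.
  by exists a; rewrite ?(subsetP sAR) // !inE aA.
have sizeA : size (enum A) = q by rewrite -cardE.
have sizeB : size (enum B) = q by rewrite -cardE.
have eq_s : s =i [pred x | (x \in R) && (x \notin A) && (x \notin B)].
  by move=> x; rewrite sR !inE negb_or andbC andbA.
exists K.+1, (enum A ++ enum B ++ s).
(* The new biclique is put in front, so all older positions shift by [2 * q]. *)
have nthE i : nth x0 (enum A ++ enum B ++ s) (2 * q + i) = nth x0 s i.
  rewrite nth_cat sizeA ifF; last by lia.
  rewrite nth_cat sizeB ifF; last by lia.
  by congr nth; lia.
split.
- rewrite !cat_uniq !enum_uniq us /= andbT !has_cat !negb_or -!andbA; apply/and3P; split.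
  + apply/hasPn=> x; rewrite !mem_enum => xB; apply/negP=> xA.
    by have := pred0P dAB x; rewrite /= xA xB.
  + by apply/hasPn=> x; rewrite eq_s !mem_enum => /andP[/andP[]].
  + by apply/hasPn=> x; rewrite eq_s !mem_enum => /andP[/andP[]].
- move=> x; rewrite !mem_cat !mem_enum eq_s inE.
  have [/(subsetP sAR)->|_] //= := boolP (x \in A).
  have [/(subsetP sBR)->|_] //= := boolP (x \in B).
  by rewrite !andbT.
- by rewrite !size_cat sizeA sizeB; lia.
- move=> [|k] i j ltkK lti ltj; last first.
    have := sbi k i j ltkK lti ltj; rewrite -nthE -(nthE (_ + j)).
    by rewrite mulnS -!addnA.
  rewrite muln0 !add0n nth_cat sizeA lti nth_cat sizeA ifF; last by lia.
  rewrite nth_cat sizeB addKn ltj; apply: cAB.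
    by rewrite -mem_enum mem_nth ?sizeA.
  by rewrite -mem_enum mem_nth ?sizeB.
- have -> // : drop (2 * q * K.+1) (enum A ++ enum B ++ s) = drop (2 * q * K) s.
  rewrite catA mulnS [2 * q + _]addnC -drop_drop drop_size_cat //.
  by rewrite size_cat sizeA sizeB mul2n addnn.
Qed.

Lemma leq_bin_expn (m k : nat) : 'C(m, k) <= m ^ k.
Proof.
elim: k m => [|k IHk] m; first by rewrite bin0.
case: m => [//|m]; rewrite -(@leq_pmul2l k.+1) // -mul_bin_diag.
rewrite expnS mulnCA leq_mul2l /=; apply: leq_trans (IHk m) _.
apply: (@leq_trans (m.+1 ^ k)); last exact: leq_pmull.
by case: k {IHk} => // k; rewrite leq_exp2r.
Qed.

Lemma card_take_enum (m : nat) (A : {set T}) :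
  m <= #|A| -> #|[set x in take m (enum A)]| = m.
Proof.
move=> lemA; rewrite cardsE.
have /card_uniqP-> : uniq (take m (enum A)) by rewrite take_uniq // enum_uniq.
by rewrite size_takel // -cardE.
Qed.

Lemma take_enum_sub (m : nat) (A : {set T}) : [set x in take m (enum A)] \subset A.
Proof. by apply/subsetP=> x; rewrite inE => /mem_take; rewrite mem_enum. Qed.

(* Each such vertex picks a q-subset of its neighbours in X; q vertices with
   the same pick would form a biclique with it. *)
Lemma card_many_neighbours (s : nat) (R X : {set T}) :
  biclique_free R -> X \subset R -> #|X| <= s ->
  #|[set u in R | q <= #|[set x in X | adj u x]|]| <= q * s ^ q.
Proof.
move=> freeR sXR cX; set Bad := [set u in R | _].
pose pick_q u := [set x in take q (enum [set x in X | adj u x])].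
pose D := [set A : {set T} | (A \subset X) && (#|A| == q)].
have pickP u : u \in Bad -> [/\ pick_q u \in D & {in pick_q u, forall x, adj u x}].
  rewrite inE => /andP[uR qu]; have sub := take_enum_sub q [set x in X | adj u x].
  split; last by move=> x /(subsetP sub); rewrite inE => /andP[].
  rewrite inE; apply/andP; split.
    by apply: subset_trans sub _; apply/subsetP=> x; rewrite inE => /andP[].
  by rewrite card_take_enum.
rewrite -sum1_card (partition_big pick_q (mem D)); last by move=> u /pickP[].
apply: (@leq_trans (\sum_(A in D) q)); last first.
  rewrite sum_nat_const mulnC leq_mul2l cards_draws; apply/orP; right.
  by apply: leq_trans (leq_bin_expn _ _) _; rewrite leq_exp2r.
apply: leq_sum => A; rewrite /= inE => /andP[sAX /eqP cA]; rewrite leqNgt; apply/negP.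
rewrite sum1_card => ltq; pose F := [set u | (u \in Bad) && (pick_q u == A)].
have cF : q <= #|F| by apply: ltnW; apply: leq_trans ltq _; rewrite cardsE.
pose B := [set x in take q (enum F)].
have sBF : B \subset F by exact: take_enum_sub.
have : ~~ biclique B A.
  apply: freeR; last exact: subset_trans sAX sXR.
  by apply: subset_trans sBF _; apply/subsetP=> x; rewrite !inE => /andP[/andP[]].
case/bicliqueP; split.
- by rewrite card_take_enum.
- exact: cA.
- move=> u a /(subsetP sBF); rewrite inE => /andP[/pickP[_ h] /eqP<-]; exact: h.
Qed.

(** A vertex with fewer than [q] neighbours in [X] costs at most [q]; each of the few others costs
    at most [s]. *)
Lemma sum_neighbours_small (s : nat) (R X : {set T}) :
  biclique_free R -> X \subset R -> #|X| <= s ->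
  \sum_(u in R) #|[set x in X | adj u x]| <= #|R| * q + q * s ^ q * s.
Proof.
move=> freeR sXR cX.
pose bad u := q <= #|[set x in X | adj u x]|.
apply: (@leq_trans (\sum_(u in R) (q + bad u * s))).
  apply: leq_sum => u _; rewrite /bad; have [_|/ltnW h] := leqP q #|_|; last by rewrite addn0.
  rewrite mul1n; apply: leq_trans (leq_addl _ _); apply: leq_trans cX.
  by apply/subset_leq_card/subsetP=> x; rewrite inE => /andP[].
rewrite big_split /= sum_nat_const -big_distrl /= leq_add2l leq_mul2r; apply/orP; right.
apply: leq_trans (card_many_neighbours freeR sXR cX).
rewrite -sum1_card big_mkcond [X in _ <= X]big_mkcond /=; apply: leq_sum => u _.
by rewrite inE; case: (u \in R).
Qed.

(** Cut [Y] into chunks of [s] vertices and apply the previous bound to each chunk. *)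
Lemma sum_neighbours (s : nat) (R Y : {set T}) : 0 < s ->
  biclique_free R -> Y \subset R ->
  \sum_(u in R) #|[set x in Y | adj u x]|
    <= (#|Y| %/ s).+1 * (#|R| * q + q * s ^ q * s).
Proof.
move=> s_gt0 freeR; have [m] := ubnP #|Y|; elim: m Y => // m IHm Y ltYm sYR.
have [cY|ltsY] := leqP #|Y| s.
  apply: leq_trans (sum_neighbours_small freeR sYR cY) _.
  exact: leq_pmull.
pose X := [set x in take s (enum Y)].
have sXY : X \subset Y by exact: take_enum_sub.
have cX : #|X| = s.
  by rewrite card_take_enum // ltnW.
have cD : #|Y :\: X| = #|Y| - s by rewrite cardsD (setIidPr sXY) cX.
have {}IHm := IHm (Y :\: X); rewrite cD in IHm.
have -> : (#|Y| %/ s).+1 = 1 + ((#|Y| - s) %/ s).+1.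
  by rewrite -{1}(subnK (ltnW ltsY)) divnDr // divnn s_gt0; lia.
rewrite mulnDl mul1n.
apply: leq_trans (leq_add (sum_neighbours_small freeR _ _) (IHm _ _)); last 1 first.
- by apply: subset_trans sYR; apply: subsetDl.
- rewrite -big_split /=; apply: leq_sum => u _.
  apply: leq_trans (leq_card_setU [set x in X | adj u x] [set x in Y :\: X | adj u x]).
  apply/subset_leq_card/subsetP=> x; rewrite !inE => /andP[xY ->].
  by rewrite xY !andbT; case: (_ \in take _ _).
- exact: subset_trans sXY sYR.
- by rewrite cX.
- by lia.
Qed.

End Graph.

(** * Encoding triangle-free graphs *)

Section Encoding.
Local Open Scope nat_scope.
Variables (T : finType) (adj : rel T) (q K : nat) (s : seq T) (x0 : T).
Hypothesis adj_triangle : forall a b c, adj a b -> adj b c -> adj a c -> False.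
Hypothesis q_gt1 : 1 < q.
Hypothesis s_size : 2 * q * K <= size s.
Hypothesis s_biclique : forall k i j, k < K -> i < q -> j < q ->
  adj (nth x0 s (2 * q * k + i)) (nth x0 s (2 * q * k + q + j)).
Let R := [set x in drop (2 * q * K) s].
Hypothesis s_free : biclique_free adj q R.

(** The size guards keep positions past the end from inheriting the neighbours of the default
    [x0]. *)
Definition adj_at (i j : nat) : bool :=
  [&& i < size s, j < size s & adj (nth x0 s i) (nth x0 s j)].

Definition adj_segment (p c : nat) : bool := has (fun i => adj_at p (c + i)) (iota 0 q).

(* Row p of the code: for the k-th biclique two flags, telling which side the
   neighbours of p lie on, followed by q bits for the offsets of these neighbours
   within that side; then one bit for every position. *)
Definition code_bit (p o : nat) : bool :=
  if o < K * (q + 2) then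
    let c := 2 * q * (o %/ (q + 2)) in
    let r := o %% (q + 2) in
    (o %/ (q + 2) <= p %/ (2 * q)) &&
    (if r == 0 then adj_segment p c
     else if r == 1 then adj_segment p (c + q)
     else adj_at p (c + (r - 2)) || adj_at p (c + q + (r - 2)))
  else [&& 2 * q * K <= p, 2 * q * K <= o - K * (q + 2)
         & adj_at p (o - K * (q + 2))].

(** Adjacency to position [j] is the conjunction of two code bits: in a biclique, the flag of the
    side of [j] and the offset bit shared by both sides. Outside the bicliques both columns
    coincide. *)
Definition code_col1 (j : nat) : nat :=
  if j < 2 * q * K then j %/ (2 * q) * (q + 2) + j %% (2 * q) %/ q
  else K * (q + 2) + j.

Definition code_col2 (j : nat) : nat :=
  if j < 2 * q * K then j %/ (2 * q) * (q + 2) + (j %% q).+2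
  else K * (q + 2) + j.

Lemma adj_at_biclique k i j : k < K -> i < q -> j < q ->
  adj_at (2 * q * k + i) (2 * q * k + q + j).
Proof.
move=> ltk lti ltj; rewrite /adj_at s_biclique // andbT.
have : 2 * q * k.+1 <= 2 * q * K by rewrite leq_mul2l ltk orbT.
by move: s_size; rewrite mulnS; lia.
Qed.

Lemma adj_at_triangle i j k : adj_at i j -> adj_at j k -> ~~ adj_at i k.
Proof.
move=> /and3P[? ? ij] /and3P[? ? jk]; apply/negP => /and3P[_ _ ik].
exact: adj_triangle ij jk ik.
Qed.

Lemma adj_segmentP p c : reflect (exists2 i, i < q & adj_at p (c + i)) (adj_segment p c).
Proof.
apply: (iffP hasP) => [[i]|[i lti pi]]; first by rewrite mem_iota add0n => lti; exists i.
by exists i; rewrite ?mem_iota.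
Qed.

(** The offset bit does not tell the sides apart. If it came from the opposite side, [p] would have
    neighbours on both sides, and the edge joining these would close a triangle. *)
Lemma code_biclique p k (side : bool) i : k < K -> i < q ->
  adj_at p (2 * q * k + side * q + i) =
  adj_segment p (2 * q * k + side * q) &&
  (adj_at p (2 * q * k + i) || adj_at p (2 * q * k + q + i)).
Proof.
move=> ltk lti; apply/idP/andP => [pi|[/adj_segmentP[j ltj pj] /orP[]]].
- split; first by apply/adj_segmentP; exists i.
  by case: side pi => [|]; rewrite ?mul1n ?mul0n ?addn0 => ->; rewrite ?orbT.
- case: side pj; rewrite ?mul1n ?mul0n ?addn0 // => pj pi.
  by have := adj_at_triangle pi (adj_at_biclique ltk lti ltj); rewrite pj.
- case: side pj; rewrite ?mul1n ?mul0n ?addn0 // => pj pi.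
  by have := adj_at_triangle pj (adj_at_biclique ltk ltj lti); rewrite pi.
Qed.

Lemma code_bitP p j : j <= p ->
  adj_at p j = code_bit p (code_col1 j) && code_bit p (code_col2 j).
Proof.
move=> lejp; rewrite /code_col1 /code_col2; case: ltnP => [ltj|lej]; last first.
  rewrite /code_bit ltnNge leq_addr /= addKn (leq_trans lej lejp) lej /=.
  by rewrite andbb.
set k := j %/ (2 * q); set i := j %% q.
have ltkK : k < K by rewrite /k ltn_divLR ?muln_gt0 ?(ltnW q_gt1) // mulnC.
have lti : i < q by rewrite /i ltn_mod ltnW.
(* Row [p] records bicliques only up to its own, so this is where [j <= p] is needed for a position
   in a biclique. *)
have lekp : k <= p %/ (2 * q) by apply: leq_div2r.
have lt_side : j %% (2 * q) %/ q < 2.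
  by rewrite ltn_divLR ?(ltnW q_gt1) // ltn_mod; lia.
have -> : adj_at p j = adj_at p (2 * q * k + j %% (2 * q) %/ q * q + i).
  congr adj_at; rewrite /i /k -(@modn_dvdm (2 * q) j q) ?dvdn_mull //.
  by rewrite -addnA -divn_eq mulnC -divn_eq.
move: lt_side; set sd := _ %/ q => lt_side.
have [side ->] : exists side : bool, sd = side.
  by case: sd lt_side => [|[|]] //; [exists false | exists true].
rewrite code_biclique // /code_bit.
(* Division by [q + 2] decodes a column into the biclique number and the place [r] in its record. *)
have dm r : r < q + 2 -> ((k * (q + 2) + r) %/ (q + 2) = k) *
    ((k * (q + 2) + r) %% (q + 2) = r) * (k * (q + 2) + r < K * (q + 2)).
  move=> ltr; have h0 : 0 < q + 2 by rewrite addn2.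
  rewrite divnMDl // (divn_small ltr) addn0 modnMDl modn_small //; split=> //.
  apply: (@leq_trans (k.+1 * (q + 2))); last by rewrite leq_mul2r ltkK orbT.
  by rewrite mulSn addnC ltn_add2r.
have lt1 : side < q + 2 by case: side; rewrite addn2.
have lt2 : i.+2 < q + 2 by rewrite addn2 !ltnS.
rewrite !(dm _ lt1) !(dm _ lt2) lekp /= !subSS subn0.
by case: side {lt1}; rewrite /= ?mul1n ?mul0n ?addn0.
Qed.

Lemma leq_code_bicliques : K * (q + 2) <= size s.
Proof.
by apply: leq_trans s_size; rewrite [leqRHS]mulnC leq_mul2l; apply/orP; right; lia.
Qed.

Lemma code_col1_lt j : j < size s -> code_col1 j < 2 * size s.
Proof.
move=> ltj; rewrite /code_col1; have lec := leq_code_bicliques.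
have [ltjK|_] := ltnP j (2 * q * K); last by lia.
have ltkK : j %/ (2 * q) < K by rewrite ltn_divLR ?muln_gt0 ?(ltnW q_gt1) // mulnC.
have lt_side : j %% (2 * q) %/ q < 2.
  by rewrite ltn_divLR ?(ltnW q_gt1) // ltn_mod; lia.
have : (j %/ (2 * q)).+1 * (q + 2) <= K * (q + 2) by rewrite leq_mul2r ltkK orbT.
by rewrite mulSn; lia.
Qed.

Lemma code_col2_lt j : j < size s -> code_col2 j < 2 * size s.
Proof.
move=> ltj; rewrite /code_col2; have lec := leq_code_bicliques.
have [ltjK|_] := ltnP j (2 * q * K); last by lia.
have ltkK : j %/ (2 * q) < K by rewrite ltn_divLR ?muln_gt0 ?(ltnW q_gt1) // mulnC.
have lti : j %% q < q by rewrite ltn_mod ltnW.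
have : (j %/ (2 * q)).+1 * (q + 2) <= K * (q + 2) by rewrite leq_mul2r ltkK orbT.
by rewrite mulSn; lia.
Qed.

Variables (L S : nat).
Hypotheses (s_uniq : uniq s) (S_gt0 : 0 < S).

Let E := [set uv : T * T | [&& uv.1 \in R, uv.2 \in R & adj uv.1 uv.2]].

(** A list containing every block that can hold a set bit: for each row the blocks up to the end of
    its biclique records, and one block for each ordered pair of adjacent vertices left over. *)
Definition code_blocks : seq (nat * nat) :=
  [seq (p, b) | p <- iota 0 (size s),
                b <- iota 0 (((p %/ (2 * q)).+1 * (q + 2)) %/ L).+1] ++
  [seq (index uv.1 s, (K * (q + 2) + index uv.2 s) %/ L) | uv <- enum E].

Lemma code_blocksP p o : code_bit p o -> (p, o %/ L) \in code_blocks.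
Proof.
rewrite /code_bit mem_cat; case: ltnP => [lto /andP[lek bit]|leo /and3P[lep lej]].
  apply/orP; left; apply/allpairsPdep; exists p, (o %/ L); split=> //.
    rewrite mem_iota /=; have at_lt j : adj_at p j -> p < size s by case/and3P.
    move: bit; case: ifP => _; first by case/adj_segmentP=> i _ /at_lt.
    case: ifP => _; first by case/adj_segmentP=> i _ /at_lt.
    by case/orP=> /at_lt.
  rewrite mem_iota /= ltnS; apply: leq_div2r; apply: ltnW.
  by rewrite -ltn_divLR ?addn2 // ltnS -addn2.
case/and3P=> ltp ltj pj; apply/orP; right; apply/mapP.
have mem_drop i : 2 * q * K <= i -> i < size s -> nth x0 s i \in R.
  move=> lei lti; rewrite inE -(subnKC lei) -nth_drop mem_nth // size_drop.
  by rewrite ltn_sub2r // (leq_ltn_trans lei).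
exists (nth x0 s p, nth x0 s (o - K * (q + 2))).
  by rewrite mem_enum inE /= pj !mem_drop.
by rewrite /= !index_uniq // subnKC.
Qed.

(** The leftover pairs are counted by [sum_neighbours] with [R] in both roles, since [R] has no
    biclique of order [q]. *)
Lemma size_code_blocks :
  size code_blocks <=
    \sum_(p < size s) (((p %/ (2 * q)).+1 * (q + 2)) %/ L).+1 +
    (size s %/ S).+1 * (size s * q + q * S ^ q * S).
Proof.
rewrite size_cat size_allpairs_dep size_map -cardE.
have -> : sumn [seq size (iota 0 (((p %/ (2 * q)).+1 * (q + 2)) %/ L).+1)
                | p <- iota 0 (size s)]
          = \sum_(p < size s) (((p %/ (2 * q)).+1 * (q + 2)) %/ L).+1.
  rewrite sumnE big_map -/(index_iota 0 (size s)) -[in iota 0 _](subn0 (size s)).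
  by rewrite -/(index_iota 0 (size s)) big_mkord; apply: eq_bigr => i _; rewrite size_iota.
rewrite leq_add2l.
have cR : #|R| <= size s.
  by rewrite cardsE; apply: leq_trans (card_size _) _; rewrite size_drop leq_subr.
have -> : #|E| = \sum_(u in R) #|[set x in R | adj u x]|.
  rewrite -sum1_card; under [RHS]eq_bigr => u _ do rewrite -sum1_card.
  rewrite pair_big_dep /=; apply: eq_bigl => -[u v]; by rewrite !inE.
apply: leq_trans (sum_neighbours (ltnW q_gt1) S_gt0 s_free (subxx R)) _.
by apply: leq_mul; [rewrite ltnS leq_div2r | rewrite leq_add2r leq_mul2r cR orbT].
Qed.

End Encoding.

Section Encode.
Local Open Scope nat_scope.

(** The interface to the memory layout: bicliques are hidden behind two column numbers per vertex,
    and a pair is looked up in the row of the later vertex. *)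
Lemma triangle_free_encoding (T : finType) (adj : rel T) (q L S : nat) :
  irreflexive adj ->
  (forall a b c, adj a b -> adj b c -> adj a c -> False) ->
  1 < q -> 0 < S -> 0 < #|T| ->
  exists (bit : nat -> nat -> bool) (pos col1 col2 : T -> nat) (nz : seq (nat * nat)),
  [/\ forall a, [/\ pos a < #|T|, col1 a < 2 * #|T| & col2 a < 2 * #|T|],
      forall a b, pos b <= pos a ->
        adj a b = bit (pos a) (col1 b) && bit (pos a) (col2 b),
      forall p o, bit p o -> p < #|T| /\ (p, o %/ L) \in nz
    & size nz <=
        \sum_(p < #|T|) (((p %/ (2 * q)).+1 * (q + 2)) %/ L).+1 +
        (#|T| %/ S).+1 * (#|T| * q + q * S ^ q * S)].
Proof.
move=> irr tri q_gt1 S_gt0 /card_gt0P[x0 _].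
have [K [s [us sT ss sbi sfree]]] := biclique_decomposition irr (ltnW q_gt1) x0 [set: T].
have sall x : x \in s by rewrite sT inE.
have szT : size s = #|T| by rewrite -(card_uniqP us); apply: eq_card => x; rewrite sall.
have posP a : index a s < size s by rewrite index_mem.
exists (code_bit adj q K s x0), (index^~ s), (fun a => code_col1 q K (index a s)),
  (fun a => code_col2 q K (index a s)), (code_blocks adj q K s L).
rewrite -szT; split.
- by move=> a; rewrite posP code_col1_lt ?code_col2_lt.
- move=> a b leba; rewrite -(code_bitP tri q_gt1 ss sbi leba).
  by rewrite /adj_at !posP !nth_index.
- move=> p o bit_po; have inb := code_blocksP L us bit_po; split=> //.
  have at_lt j : adj_at adj s x0 p j -> p < size s by case/and3P.
  move: bit_po; rewrite /code_bit.
  case: ifP => _; last by case/and3P=> _ _ /at_lt.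
  case/andP=> _; case: ifP => _; first by case/adj_segmentP=> i _ /at_lt.
  case: ifP => _; first by case/adj_segmentP=> i _ /at_lt.
  by case/orP=> /at_lt.
- exact: size_code_blocks.
Qed.
End Encode.

(** * The query program *)

Section Query.
Local Open Scope nat_scope.

(* Bit o of the row whose block pointers start at the address in register 10;
   registers 3, 5, 6 hold the word size, 2 and the number of bits per block. *)
Definition bit_code (r o : nat) : program :=
  [:: Binop OpDiv 7 o 6; Binop OpAdd 7 7 10; Read 7 7;
      Binop OpMod 8 o 6; Binop OpDiv 14 8 3; Binop OpAdd 7 7 14; Read 7 7;
      Binop OpMod 8 8 3; Binop OpShr 7 7 8; Binop OpMod r 7 5].

(* Register 9 is never written and stays 0. *)
Definition query_program : program :=
  [:: Read 3 9; Const 4 1; Const 5 2; JumpLt 3 5 15; Read 6 4; JumpEq 6 9 22;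
      (* 6: plain bit matrix *)
      Binop OpMul 6 1 6; Binop OpAdd 6 6 4; Binop OpDiv 7 2 3; Binop OpAdd 6 6 7;
      Read 6 6; Binop OpMod 7 2 3; Binop OpShr 6 6 7; Binop OpMod 0 6 5; Halt;
      (* 15: two elements *)
      JumpEq 0 9 14; JumpEq 3 4 20; JumpLt 1 2 14; Const 0 0; Halt;
      JumpLt 2 1 14; JumpEq 9 9 18;
      (* 22: compare the ranks *)
      Const 7 4; Binop OpMul 1 1 7; Binop OpMul 2 2 7; Read 10 1; Read 11 2;
      JumpLt 10 11 30; Const 0 0; Halt;
      (* 30: order the two elements by their rows *)
      Binop OpAdd 1 1 4; Binop OpAdd 2 2 4; Read 10 1; Read 11 2;
      JumpLt 11 10 37; Binop OpAdd 10 11 9; Binop OpAdd 2 1 9;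
      (* 37: both bits *)
      Binop OpAdd 2 2 4; Read 11 2; Binop OpAdd 2 2 4; Read 12 2; Read 6 5]
  ++ bit_code 13 11 ++ bit_code 11 12 ++ [:: Binop OpMul 0 13 11; Halt].

(** The longest path executes 45 instructions: 19 up to the common tail, with the two elements
    exchanged, and 26 in the tail. *)
Definition query_time : nat := 64.

Local Arguments run : simpl never.

Ltac look := rewrite /upd /=; first [eassumption | reflexivity].
Ltac read v := erewrite (@run_read _ _ _ _ _ _ _ _ _ v); [|reflexivity|look|].
Ltac binop v :=
  erewrite (@run_binop _ _ _ _ _ _ _ _ _ _ _ _ v); [|reflexivity|look|look|].

Variables (w : nat) (M : nat -> nat).
Hypothesis w_gt1 : 1 < w.
Hypothesis M_lt : forall i, M i < 2 ^ w.

Let w_lt : w < 2 ^ w. Proof. exact: ltn_expl. Qed.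

Let four_le : 4 <= 2 ^ w. Proof. by rewrite (@leq_exp2l 2 2). Qed.

(** The last conjunct is the two-level lookup: the block pointer in the table at [row], then the
    word and the bit inside the block. The bounds keep the arithmetic modulo [2 ^ w] exact. *)
Definition row_bit (L row o : nat) (b : bool) : Prop :=
  [/\ o < 2 ^ w, row + o %/ L < 2 ^ w, M (row + o %/ L) + o %% L %/ w < 2 ^ w
    & M (M (row + o %/ L) + o %% L %/ w) %/ 2 ^ (o %% L %% w) %% 2 = b].

Lemma run_matrix (R : nat -> nat) (x y W : nat) :
  R 1 = x -> R 2 = y -> R 9 = 0 -> M 0 = w -> M 1 = W -> 0 < W -> y < 2 ^ w ->
  x * W + 1 + y %/ w < 2 ^ w ->
  exists2 s, run w query_program query_time (State 0 R M) = Some s &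
    regs s 0 = M (x * W + 1 + y %/ w) %/ 2 ^ (y %% w) %% 2 /\ Defs.mem s =1 M.
Proof.
move=> Rx Ry Rz M0 M1 W_gt0 lty lt_addr; rewrite /query_time.
have lt_addr1 := leq_ltn_trans (leq_addr _ _) lt_addr.
have lt_addr0 := leq_ltn_trans (leq_addr _ _) lt_addr1.
read w => //.
rewrite (@run_const _ _ _ _ _ _ 4 1) //; last lia.
rewrite (@run_const _ _ _ _ _ _ 5 2) //; last lia.
rewrite (@run_jlt _ _ _ _ _ _ 3 5 15 false) //=; last by rewrite /upd /=; lia.
read W => //.
rewrite (@run_jeq _ _ _ _ _ _ 6 9 22 false) //; last by rewrite /upd /= Rz; lia.
binop (x * W); last by apply: eval_mul.
binop (x * W + 1); last by apply: eval_add.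
binop (y %/ w); last exact: eval_div.
binop (x * W + 1 + y %/ w); last exact: eval_add.
read (M (x * W + 1 + y %/ w)) => //.
binop (y %% w); last exact: eval_mod.
binop (M (x * W + 1 + y %/ w) %/ 2 ^ (y %% w)); last exact: eval_shr.
binop (M (x * W + 1 + y %/ w) %/ 2 ^ (y %% w) %% 2); last first.
  by apply: eval_mod; apply: leq_ltn_trans (M_lt _); apply: leq_div.
rewrite run_halt //; eexists; first reflexivity.
by split.
Qed.

(** The tail common to both orders of the elements: register 10 has the row, register 2 the address
    just before the two column numbers. The left-over fuel [t] depends on the path taken to reach
    it. *)
Lemma run_columns t (R : nat -> nat) (A row L c1 c2 : nat) (b1 b2 : bool) :
  R 2 = A -> R 10 = row -> R 3 = w -> R 4 = 1 -> R 5 = 2 -> M 2 = L ->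
  A + 2 < 2 ^ w -> M (A + 1) = c1 -> M (A + 2) = c2 ->
  row_bit L row c1 b1 -> row_bit L row c2 b2 ->
  exists2 s, run w query_program (26 + t) (State 37 R M) = Some s &
    regs s 0 = b1 && b2 /\ Defs.mem s =1 M.
Proof.
move=> RA Rrow Rw R1 R2 ML ltA Mc1 Mc2 [ltc1 lt1 lt1' bit1] [ltc2 lt2 lt2' bit2].
have b_lt : b1 * b2 < 2 ^ w.
  by rewrite mulnb (leq_ltn_trans (leq_b1 _)) // (leq_trans _ four_le).
rewrite !addSn add0n.
have div_lt x y : x < 2 ^ w -> x %/ y < 2 ^ w by apply: leq_ltn_trans; apply: leq_div.
have mod_lt x y : x < 2 ^ w -> x %% y < 2 ^ w by apply: leq_ltn_trans; apply: leq_mod.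
binop (A + 1); last by apply: eval_add; lia.
read c1 => //.
binop (A + 2); last by rewrite eval_add -addnA.
read c2 => //.
read L => //.
binop (c1 %/ L); last exact: eval_div.
binop (row + c1 %/ L); last by rewrite addnC; apply: eval_add; rewrite addnC.
read (M (row + c1 %/ L)) => //.
binop (c1 %% L); last exact: eval_mod.
binop (c1 %% L %/ w); last by apply/eval_div/mod_lt.
binop (M (row + c1 %/ L) + c1 %% L %/ w); last exact: eval_add.
read (M (M (row + c1 %/ L) + c1 %% L %/ w)) => //.
binop (c1 %% L %% w); last by apply/eval_mod/mod_lt.
binop (M (M (row + c1 %/ L) + c1 %% L %/ w) %/ 2 ^ (c1 %% L %% w)); last exact: eval_shr.
binop (nat_of_bool b1); last by rewrite eval_mod // div_lt.
binop (c2 %/ L); last exact: eval_div.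
binop (row + c2 %/ L); last by rewrite addnC; apply: eval_add; rewrite addnC.
read (M (row + c2 %/ L)) => //.
binop (c2 %% L); last exact: eval_mod.
binop (c2 %% L %/ w); last by apply/eval_div/mod_lt.
binop (M (row + c2 %/ L) + c2 %% L %/ w); last exact: eval_add.
read (M (M (row + c2 %/ L) + c2 %% L %/ w)) => //.
binop (c2 %% L %% w); last by apply/eval_mod/mod_lt.
binop (M (M (row + c2 %/ L) + c2 %% L %/ w) %/ 2 ^ (c2 %% L %% w)); last exact: eval_shr.
binop (nat_of_bool b2); last by rewrite eval_mod // div_lt.
binop (nat_of_bool (b1 && b2)); last by rewrite eval_mul // mulnb.
rewrite run_halt //; eexists; first reflexivity.
by split.
Qed.

Lemma run_compressed (R : nat -> nat) (x y L : nat) (b1 b2 : bool) :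
  R 1 = x -> R 2 = y -> R 9 = 0 -> M 0 = w -> M 1 = 0 -> M 2 = L -> 4 < 2 ^ w ->
  x * 4 + 3 < 2 ^ w -> y * 4 + 3 < 2 ^ w ->
  (let rows := if M (y * 4 + 1) < M (x * 4 + 1) then (x, y) else (y, x) in
   row_bit L (M (rows.1 * 4 + 1)) (M (rows.2 * 4 + 2)) b1 /\
   row_bit L (M (rows.1 * 4 + 1)) (M (rows.2 * 4 + 3)) b2) ->
  exists2 s, run w query_program query_time (State 0 R M) = Some s &
    regs s 0 = [&& M (x * 4) < M (y * 4), b1 & b2] /\ Defs.mem s =1 M.
Proof.
move=> Rx Ry Rz M0 M1 ML lt4 ltx lty bits; rewrite /query_time.
read w => //.
rewrite (@run_const _ _ _ _ _ _ 4 1) //; last lia.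
rewrite (@run_const _ _ _ _ _ _ 5 2) //; last lia.
rewrite (@run_jlt _ _ _ _ _ _ 3 5 15 false) //=; last by rewrite /upd /=; lia.
read 0 => //.
rewrite (@run_jeq _ _ _ _ _ _ 6 9 22 true) //; last by rewrite /upd /= Rz.
rewrite (@run_const _ _ _ _ _ _ 7 4) //.
binop (x * 4); last by apply: eval_mul; lia.
binop (y * 4); last by apply: eval_mul; lia.
read (M (x * 4)) => //.
read (M (y * 4)) => //.
rewrite (@run_jlt _ _ _ _ _ _ 10 11 30 (M (x * 4) < M (y * 4))) //.
case: ltnP => _ /=; last first.
  rewrite (@run_const _ _ _ _ _ _ 0 0) //; last lia.
  by rewrite run_halt //; eexists; first reflexivity.
binop (x * 4 + 1); last by apply: eval_add; lia.
binop (y * 4 + 1); last by apply: eval_add; lia.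
read (M (x * 4 + 1)) => //.
read (M (y * 4 + 1)) => //.
rewrite (@run_jlt _ _ _ _ _ _ 11 10 37 (M (y * 4 + 1) < M (x * 4 + 1))) //.
move: bits; case: ltnP => _ /= [bit1 bit2].
  (* The fuel is 64 minus the 17 instructions so far and the 26 of the tail; exchanging the elements
     takes two more in the other case. *)
  apply: (@run_columns 21 _ (y * 4 + 1) (M (x * 4 + 1)) L); try look.
  - by rewrite -addnA.
  - by rewrite -addnA.
  - by rewrite -addnA.
binop (M (y * 4 + 1)); last by rewrite eval_add addn0.
binop (x * 4 + 1); last by rewrite eval_add addn0; lia.
apply: (@run_columns 19 _ (x * 4 + 1) (M (y * 4 + 1)) L); try look.
- by rewrite -addnA.
- by rewrite -addnA.
- by rewrite -addnA.
Qed.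

(** Register 0 still holds the code length, 0 or 1, so halting without touching it answers 0 for the
    empty code and 1 for a successful comparison. *)
Lemma run_two (R : nat -> nat) (x y : nat) (b : bool) :
  R 0 <= 1 -> R 1 = x -> R 2 = y -> R 9 = 0 -> M 0 = b ->
  exists2 s, run w query_program query_time (State 0 R M) = Some s &
    regs s 0 = (R 0 == 1) && (if b then y < x else x < y) /\ Defs.mem s =1 M.
Proof.
move=> R0 Rx Ry Rz M0; rewrite /query_time.
read (nat_of_bool b) => //.
rewrite (@run_const _ _ _ _ _ _ 4 1) //; last lia.
rewrite (@run_const _ _ _ _ _ _ 5 2) //; last lia.
rewrite (@run_jlt _ _ _ _ _ _ 3 5 15 true) //=; last by rewrite /upd /=; case: b {M0}.
rewrite (@run_jeq _ _ _ _ _ _ 0 9 14 (R 0 == 0)) //; last by rewrite /upd /= Rz.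
case: eqP => [R00|R0n0] /=.
  by rewrite run_halt //; eexists; first reflexivity; rewrite /= /upd /= R00.
have {}R0 : R 0 = 1 by lia.
rewrite R0 (@run_jeq _ _ _ _ _ _ 3 4 20 b) //; last by rewrite /upd /=; case: b {M0}.
case: b {M0} => /=.
  rewrite (@run_jlt _ _ _ _ _ _ 2 1 14 (y < x)) //; last by rewrite /upd /= Rx Ry.
  case: ltnP => _ /=.
    by rewrite run_halt //; eexists; first reflexivity; rewrite /= /upd /= R0.
  rewrite (@run_jeq _ _ _ _ _ _ 9 9 18 true) //; last by rewrite eqxx.
  rewrite (@run_const _ _ _ _ _ _ 0 0) //; last lia.
  by rewrite run_halt //; eexists; first reflexivity.
rewrite (@run_jlt _ _ _ _ _ _ 1 2 14 (x < y)) //; last by rewrite /upd /= Rx Ry.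
case: ltnP => _ /=.
  by rewrite run_halt //; eexists; first reflexivity; rewrite /= /upd /= R0.
rewrite (@run_const _ _ _ _ _ _ 0 0) //; last lia.
by rewrite run_halt //; eexists; first reflexivity.
Qed.

End Query.

(** * Memory images *)

Section Images.
Local Open Scope nat_scope.
Variables (T : finType) (n : nat) (lab : T -> nat) (w : nat).
Hypotheses (labP : labelling n lab) (w_gt1 : 1 < w).

Lemma pack_lt B i : pack w B i < 2 ^ w.
Proof. exact: (word_of_bits_lt w (fun j => nth false B (i * w + j))). Qed.

Lemma lab_eq a b : (lab a == lab b) = (a == b).
Proof. by case: labP => inj _; apply: inj_eq. Qed.

(** * The plain bit matrix *)

Section Matrix.
Variable r : rel T.
Let W := (n %/ w).+1.
Hypothesis fits : n.+1 * W < 2 ^ w.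

Definition matrix_entry (x y : nat) : bool :=
  [exists a, exists b, [&& lab a == x, lab b == y & r a b]].

(** Word 1 is the positive row length [W], which tells the query program that the layout is not
    compressed. It takes the first word of row 0, which is free because labels start at 1. *)
Definition matrix_image (i : nat) : nat :=
  if i is i'.+1 then
    if i' is 0 then W
    else word_of_bits w (fun j => matrix_entry (i' %/ W) (i' %% W * w + j))
  else w.

Lemma matrix_structure a b :
  answers w query_program query_time
    (bits_of_words w (n.+1 * W).+1 matrix_image) (lab a) (lab b) (r a b).
Proof.
have [lab_inj lab_le] := labP.
have [/andP[la_gt0 la_le] /andP[lb_gt0 lb_le]] := (lab_le a, lab_le b).
have W_gt0 : 0 < W by [].
have ltn1 : n < 2 ^ w by apply: leq_trans (ltnW fits); rewrite leq_pmulr.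
have lt_w : w < 2 ^ w by apply: ltn_expl.
have image_lt i : matrix_image i < 2 ^ w.
  case: i => [//|[|i]] /=; last exact: word_of_bits_lt.
  by apply: leq_ltn_trans fits; rewrite leq_pmull.
have imageE i : i <= n.+1 * W ->
    pack w (bits_of_words w (n.+1 * W).+1 matrix_image) i = matrix_image i.
  by move=> lei; apply: pack_bits_of_words.
have lt_q : lab b %/ w < W by rewrite ltnS leq_div2r.
have le_addr : lab a * W + 1 + lab b %/ w <= n.+1 * W.
  rewrite mulSn [W + _]addnC -addnA add1n; apply: leq_add => //.
  by rewrite leq_mul2r la_le orbT.
set B := bits_of_words _ _ _ in imageE *.
have [||||||||s runs [s0 sM]] //= := @run_matrix w (pack w B) w_gt1 (pack_lt _)
    (regs (query_state w B (lab a) (lab b))) (lab a) (lab b) W.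
- by rewrite modn_small //; lia.
- by rewrite modn_small //; lia.
- by rewrite imageE.
- by rewrite imageE // (leq_trans _ (leq_pmulr _ _)).
- by lia.
- by lia.
exists s => //; split=> //; rewrite s0 imageE //.
rewrite addnAC addn1 /=.
(* As [lab a] is positive, the address lies beyond the two header words. *)
have [i def_i] : exists i, lab a * W + lab b %/ w = i.+1.
  exists (lab a * W + lab b %/ w).-1; rewrite prednK //.
  by rewrite addn_gt0 muln_gt0 la_gt0.
rewrite def_i /= -def_i bit_of_word_of_bits; last by rewrite ltn_mod ltnW.
rewrite divnMDl // (divn_small lt_q) addn0 modnMDl (modn_small lt_q) -divn_eq.
congr (nat_of_bool _); apply/existsP/idP => [[a' /existsP[b']]|rab].
  by rewrite !lab_eq => /and3P[/eqP-> /eqP->].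
by exists a; apply/existsP; exists b; rewrite !eqxx.
Qed.

End Matrix.

(** * The compressed layout *)

Section Compressed.
Variables (l : nat) (rank pos col1 col2 : T -> nat) (bit : nat -> nat -> bool).
Variables (nz : seq (nat * nat)) (adj : rel T).
(** Layout in words: four-word label records, [W] block pointers per row to cover its [2 * n]
    columns, then blocks of [l] words, with one extra block of zeros. [rows] and [blocks] are the
    start addresses of the last two regions. *)
Let L := l * w.
Let W := (2 * n %/ L).+1.
Let rows := 4 * n.+1.
Let blocks := rows + n * W.
Let N := blocks + (size nz).+1 * l.
Hypotheses (l_gt0 : 0 < l) (fitsL : L < 2 ^ w) (fits : N <= 2 ^ w).
Hypothesis colP : forall a, [/\ pos a < n, col1 a < 2 * n & col2 a < 2 * n].
Hypothesis adj_sym : symmetric adj.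
Hypothesis adjP : forall a b, pos b <= pos a ->
  adj a b = bit (pos a) (col1 b) && bit (pos a) (col2 b).
Hypothesis nzP : forall p o, bit p o -> p < n /\ (p, o %/ L) \in nz.
Hypothesis rank_le : forall a, rank a <= n.

(** Field 1 is the address of the pointers of the row instead of its position, so the query program
    does without [W]. *)
Definition label_entry (x f : nat) : nat :=
  if [pick a | lab a == x] is Some a then
    nth 0 [:: rank a; rows + pos a * W; col1 a; col2 a] f
  else 0.

(* Row n is empty, so it serves as the default: a block missing from nz has index
   size nz and is thus read as zeros. *)
Definition block_word (t i : nat) : nat :=
  let: (p, b) := nth (n, 0) nz t in
  word_of_bits w (fun j => bit p (b * L + (i * w + j))).

(** The header occupies the record of label 0, which no element has; the 0 in word 1 selects the
    compressed branch of the program. *)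
Definition compressed_image (i : nat) : nat :=
  if i < 4 then nth 0 [:: w; 0; L; 0] i
  else if i < rows then label_entry (i %/ 4) (i %% 4)
  else if i < blocks then
    blocks + index ((i - rows) %/ W, (i - rows) %% W) nz * l
  else block_word ((i - blocks) %/ l) ((i - blocks) %% l).

Let B := bits_of_words w N compressed_image.

Let blocks_ltN : blocks < N.
Proof. by rewrite /N -[X in X < _]addn0 ltn_add2l muln_gt0 l_gt0. Qed.

Let rows_ltN : rows < N.
Proof. exact: leq_ltn_trans (leq_addr _ _) blocks_ltN. Qed.

Let rows_lt : rows < 2 ^ w.
Proof. exact: leq_trans fits. Qed.

Lemma compressed_image_lt i : i < N -> compressed_image i < 2 ^ w.
Proof.
move=> ltiN; rewrite /compressed_image.
have ltw : w < 2 ^ w by apply: ltn_expl.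
have ltr := rows_lt.
have gt0 : 0 < 2 ^ w by rewrite expn_gt0.
have [lti4|_] := ltnP i 4; first by case: i lti4 {ltiN} => [|[|[|[|]]]].
have [_|_] := ltnP i rows.
  rewrite /label_entry; case: pickP => [a _|//].
  have [pa c1 c2] := colP a; have ra := rank_le a.
  have : rows + pos a * W < 2 ^ w.
    apply: leq_trans fits; apply: ltn_trans blocks_ltN.
    by rewrite /blocks ltn_add2l ltn_mul2r pa.
  case: (i %% 4) => [|[|[|[|f]]]] /=; rewrite /rows in ltr *; try lia.
  by rewrite nth_nil.
have [_|_] := ltnP i blocks; last first.
  by rewrite /block_word; case: nth => p b; apply: word_of_bits_lt.
apply: leq_trans fits; rewrite /N ltn_add2l ltn_mul2r l_gt0 /= ltnS.
exact: index_size.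
Qed.

Lemma pack_compressed i : i < N -> pack w B i = compressed_image i.
Proof. by move=> ltiN; apply/pack_bits_of_words/compressed_image_lt. Qed.

Lemma pack_label a f : f < 4 ->
  pack w B (lab a * 4 + f) = nth 0 [:: rank a; rows + pos a * W; col1 a; col2 a] f.
Proof.
move=> ltf; have [_ /(_ a)/andP[la_gt0 la_le]] := labP.
have lt_rows : lab a * 4 + f < rows by rewrite /rows; lia.
have lt_N : lab a * 4 + f < N.
  exact: ltn_trans rows_ltN.
rewrite pack_compressed // /compressed_image ifF; last by lia.
rewrite lt_rows divnMDl // (divn_small ltf) addn0 modnMDl (modn_small ltf) /label_entry.
case: pickP => [a'|/(_ a)]; last by rewrite eqxx.
by rewrite lab_eq => /eqP->.
Qed.

Lemma pack_row p o : p < n -> o < 2 * n ->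
  row_bit w (pack w B) L (rows + p * W) o (bit p o).
Proof.
move=> ltp lto; have w_gt0 := ltnW w_gt1.
have L_gt0 : 0 < L by rewrite muln_gt0 l_gt0.
have lt_q : o %/ L < W by rewrite ltnS leq_div2r // ltnW.
have lt_blocks : rows + p * W + o %/ L < blocks.
  rewrite /blocks -addnA ltn_add2l; apply: (@leq_trans (p.+1 * W)).
    by rewrite mulSn addnC ltn_add2r.
  by rewrite leq_mul2r ltp orbT.
set t := index (p, o %/ L) nz.
have let_nz : t < (size nz).+1 by rewrite ltnS index_size.
have lt_i : o %% L %/ w < l by rewrite ltn_divLR // ltn_mod.
have lt_N : blocks + t * l + o %% L %/ w < N.
  rewrite /N -addnA ltn_add2l; apply: (@leq_trans (t.+1 * l)).
    by rewrite mulSn addnC ltn_add2r.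
  by rewrite leq_mul2r let_nz orbT.
have rows_ge4 : 4 <= rows by rewrite /rows; lia.
have le_addr : rows <= rows + p * W + o %/ L by rewrite -addnA leq_addr.
have le_addr' : blocks <= blocks + t * l + o %% L %/ w by rewrite -addnA leq_addr.
have le_rows : rows <= blocks + t * l + o %% L %/ w.
  by apply: leq_trans le_addr'; apply: leq_addr.
have ptrE : pack w B (rows + p * W + o %/ L) = blocks + t * l.
  rewrite pack_compressed; last exact: ltn_trans blocks_ltN.
  rewrite /compressed_image ltnNge (leq_trans rows_ge4 le_addr) /= ltnNge le_addr /=.
  rewrite lt_blocks -addnA addKn divnMDl // (divn_small lt_q) addn0.
  by rewrite modnMDl (modn_small lt_q).
have lt_o : o < 2 ^ w by apply: ltn_trans rows_lt; rewrite /rows; lia.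
split=> //.
- by apply: leq_trans fits; apply: ltn_trans blocks_ltN.
- by rewrite ptrE; apply: leq_trans fits.
rewrite ptrE pack_compressed // /compressed_image.
rewrite ltnNge (leq_trans rows_ge4 le_rows) /= ltnNge le_rows /= ltnNge le_addr' /=.
rewrite -addnA addKn divnMDl // (divn_small lt_i) addn0 modnMDl (modn_small lt_i).
rewrite /block_word; have [in_nz|notin_nz] := boolP ((p, o %/ L) \in nz).
  rewrite /t nth_index // bit_of_word_of_bits ?ltn_mod //.
  by rewrite -divn_eq -divn_eq.
(* The shared block reads the empty row [n]; by [nzP] the requested bit is 0 as well. *)
rewrite nth_default; last by rewrite leqNgt index_mem.
rewrite bit_of_word_of_bits ?ltn_mod //.
case: (boolP (bit n _)) => [/nzP[]|_]; first by rewrite ltnn.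
by case: (boolP (bit p o)) => // /nzP[_]; rewrite (negbTE notin_nz).
Qed.

Lemma compressed_structure a b :
  answers w query_program query_time B (lab a) (lab b)
    ((rank a < rank b) && adj a b).
Proof.
have [_ lab_le] := labP; have ltr := rows_lt.
have [/andP[la_gt0 la_le] /andP[lb_gt0 lb_le]] := (lab_le a, lab_le b).
have [pa c1a c2a] := colP a; have [pb c1b c2b] := colP b.
have lt4N : 4 < N.
  by apply: leq_ltn_trans rows_ltN; rewrite /rows; lia.
pose b1 := if pos b < pos a then bit (pos a) (col1 b) else bit (pos b) (col1 a).
pose b2 := if pos b < pos a then bit (pos a) (col2 b) else bit (pos b) (col2 a).
(* [W] is positive, so comparing row addresses compares positions; the program thus selects the row
   that records the pair. *)
have lt_row : (rows + pos b * W < rows + pos a * W) = (pos b < pos a).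
  by rewrite ltn_add2l ltn_mul2r.
have [||||||||||s runs [s0 sM]] //= := @run_compressed w (pack w B) w_gt1 (pack_lt _)
    (regs (query_state w B (lab a) (lab b))) (lab a) (lab b) L b1 b2.
- by rewrite modn_small //; rewrite /rows in ltr; lia.
- by rewrite modn_small //; rewrite /rows in ltr; lia.
- by rewrite pack_compressed //; lia.
- by rewrite pack_compressed //; lia.
- by rewrite pack_compressed //; lia.
- by apply: leq_trans fits.
- by rewrite /rows in ltr; lia.
- by rewrite /rows in ltr; lia.
- rewrite !pack_label //= lt_row /b1 /b2.
  by case: ltnP => _ /=; rewrite !pack_label //=; split; apply: pack_row.
exists s => //; split=> //; rewrite s0.
rewrite -[lab a * 4]addn0 -[lab b * 4]addn0 !pack_label //=.
congr (nat_of_bool (_ && _)); rewrite /b1 /b2.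
by case: ltnP => [/ltnW/adjP->|/adjP] //; rewrite adj_sym => ->.
Qed.

End Compressed.
End Images.

(** * Space *)

Section Arithmetic.
Local Open Scope nat_scope.

Lemma leq_exp_lg n : n <= 2 ^ lg n.
Proof. exact: up_logP. Qed.

Lemma lg_gt1 n : 2 < n -> 1 < lg n.
Proof.
move=> n_gt2; rewrite ltnNge; apply/negP => le1.
have := leq_trans (leq_exp_lg n) (leq_pexp2l (ltn0Sn 1) le1).
by rewrite leqNgt n_gt2.
Qed.

(** With [m = lg l] at least 10, [32 * m <= 2 ^ (m - 1) < l]; the induction starts from
    [320 <= 512]. *)
Lemma lg_small l : 1024 <= l -> 32 * lg l <= l.
Proof.
move=> lel; have l_gt1 : 1 < l by apply: leq_trans lel.
have le10 : 10 <= lg l.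
  rewrite -(@leq_exp2l 2) //; exact: leq_trans lel (leq_exp_lg l).
have := up_log_gtn (ltnSn 1) l_gt1; rewrite -/(lg l).
move: (lg l) le10 => m le10 /ltnW; apply: leq_trans.
rewrite -(subnKC le10); elim: (m - 10) => [//|k IHk].
rewrite addnS /= ; rewrite addSn /= in IHk *.
rewrite expnS; apply: leq_trans (leq_mul (leqnn 2) IHk); lia.
Qed.

Variable n : nat.
Let l := lg n.
Let lam := lg l.
(** The factor 16 makes [S ^ q * S = l ^ (4 * q.+1)] at most [n], as the pigeonhole bound requires;
    the exponent 4 leaves at most [4 * n ^ 2 / l ^ 3] edges outside the bicliques. *)
Let q := l %/ (16 * lam).
Let S := l ^ 4.
Hypothesis l_large : 1024 <= l.

Let n_gt1 : 1 < n.
Proof.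
have : 0 < lg n by apply: leq_trans l_large.
by rewrite /lg up_log_gt0.
Qed.

Let lam_le : 32 * lam <= l. Proof. exact: lg_small. Qed.

Let lam_gt0 : 0 < lam.
Proof. by rewrite /lam /lg up_log_gt0; apply: leq_trans l_large. Qed.

Lemma biclique_size_gt1 : 1 < q.
Proof. by rewrite /q leq_divRL ?muln_gt0 //; lia. Qed.

Let q_le : 16 * lam * q <= l. Proof. by rewrite mulnC leq_trunc_div. Qed.

Let le_q : l <= 32 * lam * q.
Proof.
have := @ltn_ceil l (16 * lam); rewrite muln_gt0 lam_gt0 -/q => /(_ isT) h.
by have := biclique_size_gt1; nia.
Qed.

Let Sq_le : S ^ q * S <= n.
Proof.
(* From [16 * lam * q <= l] and [32 * lam <= l], the left side is at most [3 * l / 8]. *)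
have e_le : lam * (4 * q.+1) <= l.-1 by lia.
have -> : S ^ q * S = l ^ (4 * q.+1) by rewrite -expnSr /S -expnM.
apply: leq_trans (ltnW (up_log_gtn (ltnSn 1) n_gt1)).
apply: leq_trans (_ : 2 ^ (lam * (4 * q.+1)) <= _); last by rewrite leq_exp2l.
by rewrite [X in _ <= X]expnM leq_exp2r // leq_exp_lg.
Qed.

Let l3_le : l ^ 3 <= n.
Proof.
apply: leq_trans Sq_le; apply: leq_trans (_ : S <= _).
  by rewrite leq_pexp2l //; lia.
by rewrite leq_pmull // expn_gt0 expn_gt0; lia.
Qed.

(** Row [p] takes about [p * (q + 2) / (2 * q)] bits, in total about [n ^ 2 / 4 * (1 + 2 / q)], and
    [1 / q] is at most [32 * lam / l]. Multiplying by [4 * l] avoids fractions. *)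
Lemma dense_sum :
  4 * l * \sum_(p < n) ((p %/ (2 * q)).+1 * (q + 2)) <= l * n ^ 2 + 72 * lam * n ^ 2.
Proof.
have q_gt1 := biclique_size_gt1.
have step p : 2 * q * ((p %/ (2 * q)).+1 * (q + 2)) <= (q + 2) * p + 2 * q * (q + 2).
  have := leq_trunc_div p (2 * q); set d := _ %/ _ => led.
  have := leq_mul (leqnn (q + 2)) led; clear; nia.
have sum_le : 2 * q * \sum_(p < n) ((p %/ (2 * q)).+1 * (q + 2))
    <= (q + 2) * \sum_(p < n) p + 2 * q * (q + 2) * n.
  rewrite big_distrr /= [in leqRHS]big_distrr /=.
  apply: (@leq_trans (\sum_(p < n) ((q + 2) * p + 2 * q * (q + 2)))).
    by apply: leq_sum => p _; apply: step.
  by rewrite big_split /= sum_nat_const card_ord [n * _]mulnC.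
have gauss m : 2 * \sum_(p < m) p <= m ^ 2.
  elim: m => [|m IHm]; first by rewrite big_ord0.
  by rewrite big_ord_recr /= mulnDr -!mulnn in IHm *; lia.
move: sum_le (gauss n); set A := \sum_(p < n) (_ * _); set G := \sum_(p < n) _.
move=> sum_le {}gauss.
have l2n : l ^ 2 <= n by apply: leq_trans l3_le; rewrite leq_pexp2l //; lia.
have q_le_l : q <= l by nia.
rewrite -(@leq_pmul2l q); last by lia.
(* In the constant 72, the excess [2 / q] accounts for 64 and the rounding up to whole bicliques for
   8. *)
have h1 : 4 * q * A <= (q + 2) * n ^ 2 + 4 * q * (q + 2) * n by nia.
have h2 : q * (q + 2) * n * l <= 2 * q * n ^ 2.
  have le2n : (q + 2) * l <= 2 * n by nia.
  have := leq_mul (leqnn (q * n)) le2n; rewrite -mulnn; clear; nia.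
have h3 : l * n ^ 2 <= 32 * lam * q * n ^ 2 by rewrite leq_mul2r le_q orbT.
have h4 : q * n ^ 2 <= lam * q * n ^ 2 by rewrite leq_mul2r leq_pmull ?orbT.
have h5 : 4 * q * A * l <= ((q + 2) * n ^ 2 + 4 * q * (q + 2) * n) * l.
  by rewrite leq_mul2r h1 orbT.
nia.
Qed.

Variables w K : nat.
Let L := l * w.
Hypotheses (K_gt0 : 0 < K) (w_ge : 2 * l <= w) (w_le : w <= K * l).

Lemma code_size_bound (m : nat) :
  m <= \sum_(p < n) (((p %/ (2 * q)).+1 * (q + 2)) %/ L).+1 +
       (n %/ S).+1 * (n * q + q * S ^ q * S) ->
  4 * l * ((4 * n.+1 + n * (2 * n %/ L).+1 + m.+1 * l) * w)
    <= l * n ^ 2 + 140 * K * lam * n ^ 2.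
Proof.
set D := \sum_(p < n) _; set E := _ * (_ + _) => le_m.
have q_gt1 := biclique_size_gt1.
have l_gt0 : 0 < l by apply: leq_trans l_large.
have L_gt0 : 0 < L by rewrite muln_gt0 l_gt0 /= (leq_trans _ w_ge) // muln_gt0.
have S_gt0 : 0 < S by rewrite expn_gt0 l_gt0.
have n_gt0 := ltnW n_gt1.
have q_le_l : q <= l by apply: leq_trans q_le; rewrite leq_pmull // muln_gt0.
have lw_le : l * w <= K * n.
  apply: leq_trans (leq_mul (leqnn l) w_le) _; rewrite mulnCA leq_mul2l.
  by apply/orP; right; apply: leq_trans l3_le; rewrite (@leq_pexp2l l 2).
have llw_le : l * L <= K * l ^ 3.
  rewrite /L; apply: leq_trans (leq_mul (leqnn l) (leq_mul (leqnn l) w_le)) _.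
  by rewrite (_ : _ * _ = K * l ^ 3) // !expnS; lia.
have D_le : D * L <= \sum_(p < n) ((p %/ (2 * q)).+1 * (q + 2)) + n * L.
  rewrite /D big_distrl /= -[in n * L](card_ord n) -sum_nat_const -big_split /=.
  by apply: leq_sum => p _; rewrite mulSn addnC leq_add2r leq_trunc_div.
have E_le : l ^ 3 * E <= 4 * n ^ 2.
  have le1 : n * q + q * S ^ q * S <= 2 * n * l.
    rewrite -mulnA mulnC -mulnDr [2 * n * l]mulnC; apply: leq_mul => //.
    by rewrite mul2n -addnn leq_add2l.
  have le2 : (n %/ S).+1 * S <= 2 * n.
    rewrite mulSn mul2n -addnn leq_add ?leq_trunc_div //.
    by apply: leq_trans Sq_le; rewrite leq_pmull // expn_gt0 S_gt0.
  apply: (@leq_trans ((n %/ S).+1 * S * (2 * n))).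
    have -> : (n %/ S).+1 * S * (2 * n) = l ^ 3 * ((n %/ S).+1 * (2 * n * l)).
      move: (n %/ S).+1 => x; rewrite /S (expnSr l 3).
      by move: (l ^ 3) => y; clear; nia.
    by rewrite leq_mul2l leq_mul2l le1 !orbT.
  apply: leq_trans (leq_mul le2 (leqnn _)) _.
  by rewrite -mulnn; lia.
have dense := dense_sum.
have t1 : l * w * n.+1 <= 2 * K * n ^ 2.
  apply: leq_trans (leq_mul lw_le (_ : n.+1 <= 2 * n)) _; first by lia.
  by rewrite -mulnn; lia.
have t2 : n * (2 * n %/ L * L) <= 2 * n ^ 2.
  apply: leq_trans (leq_mul (leqnn n) (leq_trunc_div _ _)) _.
  by rewrite -mulnn; lia.
have t3 : n * (l * w) <= K * n ^ 2.
  by apply: leq_trans (leq_mul (leqnn n) lw_le) _; rewrite -mulnn; lia.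
have Kl3 : K * l ^ 3 <= K * n by rewrite leq_mul2l l3_le orbT.
have t4 : n * (l * L) <= K * n ^ 2.
  apply: leq_trans (leq_mul (leqnn n) (leq_trans llw_le Kl3)) _.
  by rewrite -mulnn; lia.
have t5 : l * L * E <= 4 * K * n ^ 2.
  apply: leq_trans (leq_mul llw_le (leqnn E)) _.
  by rewrite -mulnA [4 * K]mulnC -mulnA leq_mul2l E_le orbT.
have t6 : l * L <= K * n ^ 2.
  by apply: leq_trans t4; rewrite leq_pmull.
have t7 : l * (m * L) <= l * (\sum_(p < n) ((p %/ (2 * q)).+1 * (q + 2)) + n * L + E * L).
  rewrite leq_mul2l; apply/orP; right.
  by apply: leq_trans (leq_mul le_m (leqnn L)) _; rewrite mulnDl leq_add2r.
(* The [60 * K + 8] collects label records ([32 * K]), pointers ([4 * K + 8]), the additional dense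
   block of each row ([4 * K]), leftover edges ([16 * K]) and the zero block ([4 * K]). *)
have t8 : (60 * K + 8) * n ^ 2 + 72 * lam * n ^ 2 <= 140 * K * lam * n ^ 2.
  rewrite -mulnDl leq_mul2r; apply/orP; right.
  have := leq_pmulr K lam_gt0; have := leq_pmull lam K_gt0.
  by move: lam_gt0; rewrite -mulnA; move: lam (K * lam) => x y; clear; lia.
move: dense t1 t2 t3 t4 t5 t6 t7 t8 {le_m E_le D_le}; rewrite /L.
move: (\sum_(p < n) _) (2 * n %/ (l * w)) (n ^ 2) => A z n2.
clearbody E; clear; nia.
Qed.

End Arithmetic.

(** * Posets *)

Section Reduction.
Local Open Scope nat_scope.
Variables (d : Order.disp_t) (T : finPOrderType d).

Definition down_card (a : T) : nat := #|[set c | (c <= a)%O]|.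

Lemma down_card_lt a b : (a < b)%O -> down_card a < down_card b.
Proof.
move=> ltab; apply: proper_card; apply/properP; split.
  by apply/subsetP=> c; rewrite !inE => /le_trans->//; apply: ltW.
by exists b; rewrite inE ?lexx // lt_geF.
Qed.

Definition cover_adj : rel T := fun a b => trans_red a b || trans_red b a.

Lemma trans_red_lt (a b : T) : trans_red a b -> (a < b)%O.
Proof. by case/andP. Qed.

(** Down-sets grow strictly along the order, so their sizes exclude one of the two orientations of
    an edge. *)
Lemma trans_redE (a b : T) :
  trans_red a b = (down_card a < down_card b) && cover_adj a b.
Proof.
apply/idP/andP => [rab|[ltab /orP[//|/trans_red_lt/down_card_lt ltba]]].
  by rewrite /cover_adj rab; split=> //; apply/down_card_lt/trans_red_lt.
by have := ltn_trans ltab ltba; rewrite ltnn.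
Qed.

Lemma cover_adj_sym : symmetric cover_adj.
Proof. by move=> a b; rewrite /cover_adj orbC. Qed.

Lemma cover_adj_irr : irreflexive cover_adj.
Proof. by move=> a; apply/negbTE; rewrite /cover_adj orbb /trans_red ltxx. Qed.

Lemma trans_red_no_shortcut (a b c : T) :
  trans_red a b -> trans_red b c -> ~~ trans_red a c.
Proof.
move=> /trans_red_lt ab /trans_red_lt bc; rewrite /trans_red negb_and negbK.
by apply/orP; right; apply/existsP; exists b; rewrite ab.
Qed.

Lemma cover_adj_triangle (a b c : T) :
  cover_adj a b -> cover_adj b c -> cover_adj a c -> False.
Proof.
have cycle (x y z : T) : trans_red x y -> trans_red y z -> trans_red z x -> False.
  move=> /trans_red_lt xy /trans_red_lt yz /trans_red_lt zx.
  by have := lt_trans (lt_trans xy yz) zx; rewrite ltxx.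
have shortcut (x y z : T) : trans_red x y -> trans_red y z -> trans_red x z -> False.
  by move=> xy yz; apply/negP/(trans_red_no_shortcut xy yz).
(* Of the eight orientations of a triangle two are directed cycles; each of the other six has an
   edge bypassed by a path of length two. *)
rewrite /cover_adj => /orP[] ab /orP[] bc /orP[] ac.
- exact: shortcut ab bc ac.
- exact: cycle ab bc ac.
- exact: shortcut ac bc ab.
- exact: shortcut ac ab bc.
- exact: shortcut ab ac bc.
- exact: shortcut bc ac ab.
- exact: cycle bc ab ac.
- exact: shortcut bc ab ac.
Qed.

(** * Structures for two, few and many elements *)

Section Structures.
Variables (n w : nat) (lab : T -> nat).
Hypotheses (labP : labelling n lab) (w_ge : 2 * lg n <= w).

(* As lg (lg 2) = 0, only one bit is available for the three posets on two
   elements; the empty bit string has to serve as the third code. *)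
Lemma two_element_structure : n = 2 -> exists2 B : seq bool, size B <= 1 &
  forall a b : T, answers w query_program query_time B (lab a) (lab b) (trans_red a b).
Proof.
move=> n2; have [lab_inj lab_le] := labP.
have w_gt1 : 1 < w by move: w_ge; rewrite n2.
have lab12 (a b : T) : lab a < lab b -> lab a = 1 /\ lab b = 2.
  by have := lab_le a; have := lab_le b; rewrite n2; lia.
have four_le : 4 <= 2 ^ w by rewrite (@leq_exp2l 2 2).
have answerP (B : seq bool) (b : bool) : size B <= 1 -> nth false B 0 = b ->
    (forall x y : T, trans_red x y =
       (size B == 1) && (if b then lab y < lab x else lab x < lab y)) ->
    forall x y : T, answers w query_program query_time B (lab x) (lab y) (trans_red x y).
  move=> szB nB redE x y.
  have szE : size B %% 2 ^ w = size B by rewrite modn_small //; lia.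
  have labE z : lab z %% 2 ^ w = lab z.
    by rewrite modn_small //; have := lab_le z; rewrite n2; lia.
  have [|||||s runs [s0 sM]] //= := @run_two w (pack w B) w_gt1
    (regs (query_state w B (lab x) (lab y))) (lab x) (lab y) b.
  - by rewrite szE.
  - have -> : pack w B 0 = word_of_bits w (nth false B) by [].
    have w0 : w = w.-1.+1 by rewrite prednK // ltnW.
    rewrite w0 word_of_bitsS nB /word_of_bits big1 ?addn0 // => i _.
    by rewrite nth_default ?(leq_trans szB).
  by exists s => //; split=> //; rewrite s0 /= szE -redE.
(* Three cases: an edge towards the larger label gets the bit 0, an edge towards the smaller label
   the bit 1, and no edge the empty string. *)
have [/existsP[a0 /existsP[b0 /andP[lt0 r0]]]|none] :=
    boolP [exists a, exists b, (lab a < lab b) && trans_red a b].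
  have [a1 b2] := lab12 _ _ lt0.
  exists [:: false] => //; apply: (answerP _ false) => // x y /=; apply/idP/idP => [rxy|ltxy].
    rewrite ltnNge leq_eqVlt; apply/norP; split.
      by apply/eqP=> /lab_inj exy; move: (trans_red_lt rxy); rewrite exy ltxx.
    apply/negP => /lab12[y1 x2].
    have ea : y = a0 by apply: lab_inj; rewrite y1.
    have eb : x = b0 by apply: lab_inj; rewrite x2.
    rewrite ea eb in rxy; have := lt_trans (trans_red_lt r0) (trans_red_lt rxy).
    by rewrite ltxx.
  have [x1 y2] := lab12 _ _ ltxy.
  have -> : x = a0 by apply: lab_inj; rewrite x1.
  by have -> : y = b0 by apply: lab_inj; rewrite y2.
have [/existsP[a0 /existsP[b0 /andP[lt0 r0]]]|none'] :=
    boolP [exists a, exists b, (lab b < lab a) && trans_red a b].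
  have [b1 a2] := lab12 _ _ lt0.
  exists [:: true] => //; apply: (answerP _ true) => // x y /=; apply/idP/idP => [rxy|ltxy].
    rewrite ltnNge leq_eqVlt; apply/norP; split.
      by apply/eqP=> /lab_inj exy; move: (trans_red_lt rxy); rewrite exy ltxx.
    apply: contra none => ltxy; apply/existsP; exists x; apply/existsP; exists y.
    by rewrite ltxy.
  have [y1 x2] := lab12 _ _ ltxy.
  have -> : x = a0 by apply: lab_inj; rewrite x2.
  by have -> : y = b0 by apply: lab_inj; rewrite y1.
exists [::] => //; apply: (answerP _ false) => // x y /=; apply/negbTE/negP => rxy.
have [ltxy|ltyx|/lab_inj exy] := ltngtP (lab x) (lab y).
- by case/existsP: none; exists x; apply/existsP; exists y; rewrite ltxy.
- by case/existsP: none'; exists x; apply/existsP; exists y; rewrite ltyx.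
- by move: (trans_red_lt rxy); rewrite exy ltxx.
Qed.

Let exp_ge : n ^ 2 <= 2 ^ w.
Proof.
apply: (@leq_trans (2 ^ (2 * lg n))); last by rewrite leq_exp2l.
by rewrite mulnC expnM leq_exp2r // leq_exp_lg.
Qed.

Lemma small_structure : 3 <= n -> exists2 B : seq bool,
    size B = (n.+1 * (n %/ w).+1).+1 * w &
    forall a b : T, answers w query_program query_time B (lab a) (lab b) (trans_red a b).
Proof.
move=> n_ge3; have lg_ge2 := lg_gt1 n_ge3.
have w_ge4 : 4 <= w by lia.
have fits : n.+1 * (n %/ w).+1 < 2 ^ w.
  apply: leq_trans exp_ge.
  (* Words have at least 4 bits as [n >= 3], which brings the matrix below [n ^ 2] words, within the
     address range. *)
  have leq4 : n %/ w <= n %/ 4 by apply: leq_div2l.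
  apply: leq_ltn_trans (leq_mul (leqnn _) (_ : (n %/ w).+1 <= (n %/ 4).+1)) _ => //.
  by have := leq_trunc_div n 4; move: (n %/ 4) => z lez; rewrite -mulnn; nia.
have w_gt1 : 1 < w by lia.
exists (bits_of_words w (n.+1 * (n %/ w).+1).+1 (matrix_image n lab w (@trans_red d T))).
  by rewrite size_mkseq.
exact: matrix_structure.
Qed.

Lemma large_structure (K : nat) :
  #|T| = n -> 0 < K -> w <= K * lg n ->
  1024 <= lg n -> 5 * K + 1 <= lg n -> exists2 B : seq bool,
    4 * lg n * size B <= lg n * n ^ 2 + 140 * K * lg (lg n) * n ^ 2 &
    forall a b : T, answers w query_program query_time B (lab a) (lab b) (trans_red a b).
Proof.
move=> cT K_gt0 w_le l_large l_geK; set l := lg n.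
have l_gt0 : 0 < l by apply: leq_trans l_large.
have n_gt0 : 0 < n by move: l_gt0; rewrite /l /lg up_log_gt0 => /andP[_ /ltnW].
have w_gt1 : 1 < w by apply: leq_trans w_ge; rewrite -[2]muln1 leq_mul.
have lam_le := lg_small l_large.
have S_gt0 : 0 < l ^ 4 by rewrite expn_gt0 l_gt0.
have cT_gt0 : 0 < #|T| by rewrite cT.
have [bit [pos [col1 [col2 [nz]]]]] := triangle_free_encoding (l * w)
  cover_adj_irr cover_adj_triangle (biclique_size_gt1 l_large) S_gt0 cT_gt0.
rewrite cT => -[colP adjP nzP size_nz].
have bound := code_size_bound l_large K_gt0 w_ge w_le size_nz.
set N := _ + _ * l in bound.
(* The space bound itself shows that addresses fit: [N * w <= (5 * K + 1) * n ^ 2 <= w * n ^ 2],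
   hence [N <= n ^ 2]. *)
have fits : N <= 2 ^ w.
  apply: leq_trans exp_ge.
  have h1 : 4 * l * (N * w) <= l * (5 * K + 1) * n ^ 2.
    apply: leq_trans bound _; rewrite -mulnDl leq_mul2r; apply/orP; right.
    have := leq_mul (leqnn (5 * K)) lam_le; rewrite -/l.
    by move: (lg l) => x; clear; nia.
  have h2 : N * w <= w * n ^ 2.
    apply: (@leq_trans ((5 * K + 1) * n ^ 2)).
      rewrite -(@leq_pmul2l l) // [leqRHS]mulnA; apply: leq_trans h1.
      by rewrite leq_mul2r leq_pmull ?orbT.
    by rewrite leq_mul2r (leq_trans l_geK) ?orbT // (leq_trans _ w_ge) // leq_pmull.
  by move: h2; rewrite mulnC leq_pmul2l // ltnW.
(* Split [2 ^ w] as [2 ^ l * 2 ^ (w - l)]: the first factor exceeds [l], and the second is at least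
   [w] because [w >= 2 * l]. *)
have fitsL : l * w < 2 ^ w.
  have [m [defw m_gt0]] : exists m, w = l + m.+1 /\ w <= 2 * m.+1.
    by exists (w - l).-1; move: w_ge l_gt0; rewrite -/l; clear; lia.
  rewrite {2}defw expnD; apply: (@leq_ltn_trans (l * 2 ^ m.+1)).
    rewrite leq_mul2l; apply/orP; right; apply: leq_trans m_gt0 _.
    by rewrite expnS leq_mul2l /= ltn_expl.
  by rewrite ltn_mul2r expn_gt0 ltn_expl.
exists (bits_of_words w N
    (compressed_image n lab w l down_card pos col1 col2 bit nz)).
  by rewrite size_mkseq.
move=> a b; rewrite trans_redE; apply: compressed_structure => //.
- exact: cover_adj_sym.
- by move=> x; rewrite -cT max_card.
Qed.

End Structures.
End Reduction.

(** * Combining the cases into one space bound *)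

Section Assembly.
Local Open Scope nat_scope.

(** Below the threshold both [n] and [w] are bounded, hence so is the size of the plain matrix. *)
Lemma small_size_bounded (K l0 : nat) : exists c : nat, forall n w : nat,
  w <= K * lg n -> lg n < l0 -> (n.+1 * (n %/ w).+1).+1 * w <= c.
Proof.
exists ((2 ^ l0).+1 * (2 ^ l0 + K * l0) + K * l0) => n w w_le small.
have n_le : n <= 2 ^ l0.
  by apply: leq_trans (leq_exp_lg n) _; rewrite leq_exp2l // ltnW.
have wn_le : w <= K * l0.
  by apply: leq_trans w_le _; rewrite leq_mul2l ltnW ?orbT.
rewrite mulSn addnC; apply: leq_add => //.
rewrite -mulnA; apply: leq_mul; first by rewrite ltnS.
by rewrite mulSn addnC; apply: leq_add => //; apply: leq_trans (leq_trunc_div _ _) _.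
Qed.

Local Open Scope ring_scope.

Lemma space_bound (c l lam n m : nat) : (0 < l)%N ->
  (4 * l * m <= l * n ^ 2 + 4 * c * lam * n ^ 2)%N ->
  m%:R <= n%:R ^+ 2 / 4%:R + c%:R * (n%:R ^+ 2 * lam%:R / l%:R) :> rat.
Proof.
move=> l_gt0 le_m; have l_neq0 : l%:R != 0 :> rat by rewrite pnatr_eq0 -lt0n.
rewrite -(@ler_pM2l _ (4 * l)%N%:R) ?ltr0n ?muln_gt0 // -natrM.
move: le_m; rewrite -(ler_nat rat) => /le_trans; apply.
rewrite le_eqVlt; apply/orP; left; apply/eqP.
by rewrite natrD !natrM; field.
Qed.

End Assembly.

Theorem theorem2 (w : nat -> nat) (hw : word_size_Theta_lg w) :
  exists (c : rat) (t : nat) (p : program),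
    0 < c /\
    forall n : nat, (2 <= n)%N ->
    forall (d : Order.disp_t) (T : finPOrderType d), #|T| = n ->
    forall lab : T -> nat, labelling n lab ->
    exists B : seq bool,
      (size B)%:R <= n%:R ^+ 2 / 4%:R
                     + c * (n%:R ^+ 2 * (lg (lg n))%:R / (lg n)%:R) /\
      forall a b : T, answers (w n) p t B (lab a) (lab b) (trans_red a b).
Proof.
have [w_ge [K0 w_le0]] := hw.
have [K K_gt0 w_le] : exists2 K, (0 < K)%N & forall n, (2 <= n)%N -> (w n <= K * lg n)%N.
  exists K0.+1 => // n /w_le0 /leq_trans; apply.
  by rewrite leq_mul2r leqnSn orbT.
pose l0 := maxn 1024 (5 * K + 1).
have [c_small c_smallP] := small_size_bounded K l0.
(* 35 is a quarter of the 140 in the large case; [c_small] absorbs the sizes below the threshold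
   [l0]. *)
exists (35 * K + c_small)%N%:R, query_time, query_program; split.
  by rewrite ltr0n addn_gt0 muln_gt0 K_gt0.
move=> n n_ge2 d T cT lab labP.
have [n_eq2|n_ne2] := eqVneq n 2%N.
  have [B szB ansB] := two_element_structure labP (w_ge n n_ge2) n_eq2.
  exists B; split; last exact: ansB.
  (* The error term vanishes here, leaving exactly one bit. *)
  rewrite n_eq2 (_ : lg (lg 2) = 0%N) //.
  by rewrite mulr0n [_ ^+ 2 * 0]mulr0 mul0r mulr0 addr0 -natrX divff ?pnatr_eq0 // lern1.
have n_ge3 : (3 <= n)%N by rewrite ltn_neqAle eq_sym n_ne2.
have l_gt1 := lg_gt1 n_ge3.
have lam_gt0 : (0 < lg (lg n))%N by rewrite /lg up_log_gt0.
have [|small] := leqP l0 (lg n).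
  rewrite geq_max => /andP[large largeK].
  have [B szB ansB] :=
    large_structure labP (w_ge n n_ge2) cT K_gt0 (w_le n n_ge2) large largeK.
  exists B; split=> //; apply: space_bound; first exact: ltnW.
  apply: leq_trans szB _.
  rewrite leq_add2l !leq_mul2r; apply/orP; right; apply/orP; right.
  by rewrite mulnDr mulnA leq_addr.
have [B szB ansB] := small_structure labP (w_ge n n_ge2) n_ge3.
exists B; split=> //; apply: space_bound; first exact: ltnW.
rewrite szB; apply: leq_trans (leq_addl _ _).
have size_le := c_smallP n (w n) (w_le n n_ge2) small.
(* With [lg (lg n)] positive, this makes the error term at least its coefficient, which covers the
   bounded size. *)
have l_le : (lg n <= n ^ 2)%N.
  apply: leq_trans (_ : n <= _)%N; last by rewrite -mulnn leq_pmull // ltnW.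
  by apply: up_log_min => //; rewrite ltnW // ltn_expl.
rewrite -!mulnA leq_mul2l /=; apply: leq_trans (leq_mul l_le size_le) _.
rewrite [leqRHS]mulnA mulnC; apply: leq_mul => //.
by apply: leq_trans (leq_addl (35 * K) c_small) _; rewrite leq_pmulr.
Qed.
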